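(* Let $\mathsf L$ be a logic obtained by adding to the language of $\mathbf{CPL}^+$ new atoms having the empty team property (e.g. independence atoms, giving $\mathbf{PI}^+$, or inclusion atoms, giving $\mathbf{PInc}^+$). For any set $\Gamma\cup\{\phi\}$ of formulas in the language of $\mathsf L$: if $\Gamma\vdash\phi$ in the natural deduction system of $\mathsf L$, then $\Gamma\models\phi$.
   Context: $\mathbf{CPL}^+$ formulas: $\phi::=p_i\mid\neg p_i\mid\bot\mid\mathrm{NE}\mid\phi\wedge\phi\mid\phi\otimes\phi$. A valuation on $N\subseteq\mathbb N$ is $s:N\to\{0,1\}$, a team on $N$ a set of such. Semantics: $X\models p_i$ iff $s(i)=1$ for all $s\in X$; $X\models\neg p_i$ iff $s(i)=0$ for all $s\in X$; $X\models\bot$ iff $X=\emptyset$; $X\models\mathrm{NE}$ iff $X\ne\emptyset$; $\wedge$ as usual; $X\models\phi\otimes\psi$ iff $X=Y\cup Z$ with $Y\models\phi$, $Z\models\psi$. Each new atom $\alpha$ involves finitely many variables and has a team semantics depending only on the restriction of the team to the indices of these variables, with $\emptyset\models\alpha$ (e.g. $X\models p_{\vec i}\perp p_{\vec j}$ iff for all $s,s'\in X$ some $s''\in X$ has $s''(\vec i)=s(\vec i)$, $s''(\vec j)=s'(\vec j)$; $X\models p_{\vec i}\subseteq p_{\vec j}$ iff for all $s\in X$ some $s'\in X$ has $s(\vec i)=s'(\vec j)$). $\Gamma\models\phi$: every team satisfying all of $\Gamma$ satisfies $\phi$. Classical formulas: built from $p_i,\neg p_i,\bot$ by $\wedge,\otimes$.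 $p_i^1=p_i$, $p_i^0=\neg p_i$; empty $\otimes$ is $\bot$; for a team $X$ on finite $N=\{i_1,\dots,i_n\}$, $\Theta^*_X=\bigotimes_{s\in X}(p_{i_1}^{s(i_1)}\wedge\dots\wedge p_{i_n}^{s(i_n)}\wedge\mathrm{NE})$. Formulas are strings numbered from the left; $[\psi,m]$ is the occurrence of subformula $\psi$ starting at symbol $m$, $\phi(\beta/[\psi,m])$ replaces it by $\beta$. Natural deduction system of $\mathsf L$ (derivations with discharge; no substitution rule): Axiom $p_i\otimes\neg p_i$ (each $i$). Rules: standard $\wedge$-introduction/elimination; from $\phi$ infer $\phi\otimes\psi$ if $\psi$ has no $\mathrm{NE}$; from $\phi$ infer $\phi\otimes\phi$; from $\phi\otimes\psi$ and derivations of $\alpha$ from $\phi$ and from $\psi$ (discharged) infer $\alpha$, provided $\alpha$ and the other undischarged assumptions of the subderivations are classical; from $\phi\otimes\psi$ and a derivation of $\chi$ from $\psi$ (discharged) infer $\phi\otimes\chi$, provided the other undischarged assumptions of that subderivation are classical; from $\phi\otimes\psi$ infer $\psi\otimes\phi$; from $\phi\otimes(\psi\otimes\chi)$ infer $(\phi\otimes\psi)\otimes\chi$; from $p_i\wedge\neg p_i$ infer $\bot$; from $\phi\otimes\bot$ infer $\phi$; from $\bot\wedge\mathrm{NE}$ infer any $\phi$; from $\phi\otimes(\bot\wedge\mathrm{NE})$ infer $\bot\wedge\mathrm{NE}$; from $\Theta^*_X\wedge\Theta^*_Y$ infer $\bot\wedge\mathrm{NE}$ for distinct teams $X,Y$ on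 the same finite index set; from $\alpha\wedge(\psi\otimes\chi)$ infer $(\alpha\wedge\psi)\otimes(\alpha\wedge\chi)$ for classical $\alpha$; Strong elimination 1: for a finite $N$ with $Y_1,\dots,Y_k$ all nonempty teams on $N$ and an occurrence $[\mathrm{NE},m]$ in $\phi$: from $\phi$ and derivations of $\theta$ from each $\phi(\Theta^*_{Y_j}/[\mathrm{NE},m])$ (discharged) infer $\theta$; Strong elimination 2: for an occurrence $[\psi,m]$ in $\phi$: from $\phi$ and derivations of $\theta$ from $\phi(\psi\wedge\bot/[\psi,m])$ and from $\phi(\psi\wedge\mathrm{NE}/[\psi,m])$ infer $\theta$; and for each new atom $\alpha$: $\alpha$-introduction: from $\Theta^*_Y$ infer $\alpha$, where $Y$ is a team on a finite index set $N$ (containing the indices of $\alpha$) with $Y\models\alpha$; strong $\alpha$-elimination: for an occurrence $[\alpha,m]$ in $\phi$ and $Y_1,\dots,Y_k$ all teams on a finite $N$ (containing the indices of $\alpha$) satisfying $\alpha$: from $\phi$ and derivations of $\theta$ from each $\phi(\Theta^*_{Y_j}/[\alpha,m])$ (discharged) infer $\theta$. *)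

(* Defs.v *)
From mathcomp Require Import all_boot finmap.
From mathcomp Require Import zify.
From mathcomp Require Import boolp classical_sets functions cardinality.

Set Implicit Arguments.
Unset Strict Implicit.
Unset Printing Implicit Defensive.

Local Open Scope classical_set_scope.

(* [N : set nat] coerces to the subtype of its elements, so [N -> bool] is the
   type of valuations on [N]. *)
Notation team N := (set (set_type N -> bool)).

Section Teams.
Variable N : set nat.

(* [value s i = Some b] iff [i] belongs to the domain [N] and s(i) = b. *)
Definition value (s : N -> bool) (i : nat) : option bool := omap s (insub i).

Definition inclusion (M : set nat) (MN : M `<=` N) (i : M) : N :=
  SigSub (mem_set (MN _ (set_mem (valP i)))).

Definition restrict (M : set nat) (MN : M `<=` N) (X : team N) : team M :=
  [set s \o inclusion MN | s in X].

End Teams.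

Lemma value_restrict (N M : set nat) (MN : M `<=` N) (s : N -> bool) (i : nat) :
  M i -> value (s \o inclusion MN) i = value s i.
Proof.
move=> Mi; have iM := mem_set Mi; have iN := mem_set (MN _ Mi).
rewrite /value (insubT (mem M) iM) (insubT (mem N) iN) /=.
by congr (Some (s _)); apply/val_inj.
Qed.

(* The collection of new atoms added to CPL+. *)
Record newAtoms := NewAtoms {
  atom : Type;
  atom_idx : atom -> {fset nat};
  atom_sat : atom -> forall N : set nat, team N -> Prop;
  atom_sat_local : forall (a : atom) (N : set nat)
      (aN : [set` atom_idx a] `<=` N) (X : team N),
    atom_sat a X <-> atom_sat a (restrict aN X);
  atom_sat_empty : forall (a : atom) (N : set nat),
    [set` atom_idx a] `<=` N -> atom_sat a (set0 : team N)
}.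

(* Independence atoms: the logic PI+. *)
Section Independence.

Definition indep_idx (a : seq nat * seq nat) : {fset nat} :=
  [fset i in a.1 ++ a.2]%fset.

Definition indep_sat (a : seq nat * seq nat) (N : set nat) (X : team N) : Prop :=
  forall s s', X s -> X s' -> exists s'', [/\ X s'',
    map (value s'') a.1 = map (value s) a.1 &
    map (value s'') a.2 = map (value s') a.2].

Lemma indep_sat_local a N (aN : [set` indep_idx a] `<=` N) (X : team N) :
  indep_sat a X <-> indep_sat a (restrict aN X).
Proof.
have E1 s : map (value (s \o inclusion aN)) a.1 = map (value s) a.1.
  apply/eq_in_map => i ia; apply: value_restrict.
  by rewrite /= /indep_idx in_fset mem_cat ia.
have E2 s : map (value (s \o inclusion aN)) a.2 = map (value s) a.2.
  apply/eq_in_map => i ia; apply: value_restrict.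
  by rewrite /= /indep_idx in_fset mem_cat ia orbT.
split=> [H _ _ [s Xs <-] [s' Xs' <-]|H s s' Xs Xs'].
  have [t [Xt t1 t2]] := H _ _ Xs Xs'.
  by exists (t \o inclusion aN); rewrite !E1 !E2; split=> //; exists t.
have [||_ [[t Xt <-]]] := H (s \o inclusion aN) (s' \o inclusion aN).
- by exists s.
- by exists s'.
by rewrite !E1 !E2 => t1 t2; exists t.
Qed.

Lemma indep_sat_empty a (N : set nat) :
  [set` indep_idx a] `<=` N -> indep_sat a (set0 : team N).
Proof. by move=> _ s s' []. Qed.

Definition indep_atoms : newAtoms :=
  NewAtoms indep_sat_local indep_sat_empty.

End Independence.

(* Inclusion atoms: the logic PInc+. *)
Section Inclusion.

Definition incl_atom := {n : nat & (n.-tuple nat * n.-tuple nat)%type}.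

Definition incl_idx (a : incl_atom) : {fset nat} :=
  [fset i in (tagged a).1 ++ (tagged a).2 : seq nat]%fset.

Definition incl_sat (a : incl_atom) (N : set nat) (X : team N) : Prop :=
  forall s, X s -> exists2 s', X s' &
    map (value s) (tagged a).1 = map (value s') (tagged a).2.

Lemma incl_sat_local a N (aN : [set` incl_idx a] `<=` N) (X : team N) :
  incl_sat a X <-> incl_sat a (restrict aN X).
Proof.
have E1 s : map (value (s \o inclusion aN)) (tagged a).1
    = map (value s) (tagged a).1.
  apply/eq_in_map => i ia; apply: value_restrict.
  by rewrite /= /incl_idx in_fset mem_cat ia.
have E2 s : map (value (s \o inclusion aN)) (tagged a).2
    = map (value s) (tagged a).2.
  apply/eq_in_map => i ia; apply: value_restrict.
  by rewrite /= /incl_idx in_fset mem_cat ia orbT.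
split=> [H _ [s Xs <-]|H s Xs].
  have [t Xt t1] := H _ Xs.
  by exists (t \o inclusion aN); rewrite ?E1 ?E2 //; exists t.
have [|_ [t Xt <-]] := H (s \o inclusion aN); first by exists s.
by rewrite !E1 !E2 => t1; exists t.
Qed.

Lemma incl_sat_empty a (N : set nat) :
  [set` incl_idx a] `<=` N -> incl_sat a (set0 : team N).
Proof. by move=> _ s []. Qed.

Definition incl_atoms : newAtoms :=
  NewAtoms incl_sat_local incl_sat_empty.

End Inclusion.

Section Syntax.
Variable L : newAtoms.

Inductive form :=
| Var of nat
| NegVar of nat
| Bot
| NE
| Atom of atom L
| And of form & form
| Tensor of form & form.

Fixpoint idx (phi : form) : set nat :=
  match phi with
  | Var i | NegVar i => [set i]
  | Bot | NE => set0
  | Atom a => [set` atom_idx a]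
  | And psi chi | Tensor psi chi => idx psi `|` idx chi
  end.

Fixpoint classical (phi : form) : Prop :=
  match phi with
  | Var _ | NegVar _ | Bot => True
  | NE | Atom _ => False
  | And psi chi | Tensor psi chi => classical psi /\ classical chi
  end.

Fixpoint NE_free (phi : form) : Prop :=
  match phi with
  | NE => False
  | Var _ | NegVar _ | Bot | Atom _ => True
  | And psi chi | Tensor psi chi => NE_free psi /\ NE_free chi
  end.

Inductive symbol :=
| SVar of nat | SNeg | SBot | SNE | SAtom of atom L
| SAnd | STensor | SLeft | SRight.

Fixpoint str (phi : form) : seq symbol :=
  match phi with
  | Var i => [:: SVar i]
  | NegVar i => [:: SNeg; SVar i]
  | Bot => [:: SBot]
  | NE => [:: SNE]
  | Atom a => [:: SAtom a]
  | And psi chi => SLeft :: str psi ++ SAnd :: str chi ++ [:: SRight]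
  | Tensor psi chi => SLeft :: str psi ++ STensor :: str chi ++ [:: SRight]
  end.

(* [subform_at phi m = Some psi] iff [psi, m] is an occurrence in [phi]. Symbols
   of [str phi] are numbered from 1; a negated variable is a literal and has no
   proper subformula. As formulas are fully parenthesized, at most one
   subformula starts at a given symbol. *)
Fixpoint subform_at (phi : form) (m : nat) : option form :=
  if m == 1 then Some phi else
  match phi with
  | And psi chi | Tensor psi chi =>
      if m <= (size (str psi)).+1 then subform_at psi m.-1
      else subform_at chi (m - (size (str psi)).+2)
  | _ => None
  end.

(* phi(beta/[psi, m]), where [psi, m] is the occurrence starting at [m]. *)
Fixpoint replace (beta phi : form) (m : nat) : form :=
  if m == 1 then beta else
  match phi with
  | And psi chi =>
      if m <= (size (str psi)).+1 then And (replace beta psi m.-1) chi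
      else And psi (replace beta chi (m - (size (str psi)).+2))
  | Tensor psi chi =>
      if m <= (size (str psi)).+1 then Tensor (replace beta psi m.-1) chi
      else Tensor psi (replace beta chi (m - (size (str psi)).+2))
  | _ => phi
  end.

Lemma subform_at_str (phi psi : form) (m : nat) :
  subform_at phi m = Some psi ->
  exists u v, [/\ m = (size u).+1, str phi = u ++ str psi ++ v
    & forall beta, str (replace beta phi m) = u ++ str beta ++ v].
Proof.
elim: phi m => [i|i|||a|p IHp q IHq|p IHp q IHq] m /=;
  (case: eqP => [-> [<-]|m1] //;
     first by exists [::], [::]; split=> //= *; rewrite ?cats0);
  case: leqP => lem.
- case: m m1 lem => [|m] m1 lem /=.
    by move=> /IHp[u [v []]].
  move=> /IHp[u [v [em -> E]]].
  exists (SLeft :: u), (v ++ SAnd :: str q ++ [:: SRight]).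
  split=> [||beta].
  + by rewrite /= em.
  + by rewrite /= -!catA.
  + by rewrite /= E -!catA.
- move=> /IHq[u [v [em -> E]]].
  exists (SLeft :: str p ++ SAnd :: u), (v ++ [:: SRight]); split=> [||beta].
  + rewrite /= size_cat /= -(subnKC lem) em; lia.
  + by rewrite /= -!catA /= -?catA.
  + by rewrite /= E -!catA /= -?catA.
- case: m m1 lem => [|m] m1 lem /=.
    by move=> /IHp[u [v []]].
  move=> /IHp[u [v [em -> E]]].
  exists (SLeft :: u), (v ++ STensor :: str q ++ [:: SRight]).
  split=> [||beta].
  + by rewrite /= em.
  + by rewrite /= -!catA.
  + by rewrite /= E -!catA.
- move=> /IHq[u [v [em -> E]]].
  exists (SLeft :: str p ++ STensor :: u), (v ++ [:: SRight]); split=> [||beta].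
  + rewrite /= size_cat /= -(subnKC lem) em; lia.
  + by rewrite /= -!catA /= -?catA.
  + by rewrite /= E -!catA /= -?catA.
Qed.

Fixpoint sat (N : set nat) (X : team N) (phi : form) : Prop :=
  match phi with
  | Var i => forall s, X s -> value s i = Some true
  | NegVar i => forall s, X s -> value s i = Some false
  | Bot => X = set0
  | NE => X <> set0
  | Atom a => atom_sat a X
  | And psi chi => sat X psi /\ sat X chi
  | Tensor psi chi =>
      exists Y Z : team N, [/\ X = Y `|` Z, sat Y psi & sat Z chi]
  end.

(* The teams considered are those on any set of indices [N] containing the
   indices of all the formulas involved, so that satisfaction is defined. *)
Definition entails (Gamma : set form) (phi : form) : Prop :=
  forall (N : set nat) (X : team N),
    (forall psi, Gamma psi -> idx psi `<=` N) -> idx phi `<=` N ->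
    (forall psi, Gamma psi -> sat X psi) -> sat X phi.

Definition literal (i : nat) (b : bool) : form := if b then Var i else NegVar i.

Fixpoint bigTensor (fs : seq form) : form :=
  match fs with
  | [::] => Bot
  | [:: phi] => phi
  | phi :: fs' => Tensor phi (bigTensor fs')
  end.

(* Theta*_X, meaningful for finite [N] only ([fset_set] of an infinite set is
   empty); the enumerations of [N] and [X] are those chosen by [fset_set]. *)
Definition Theta (N : set nat) (X : team N) : form :=
  bigTensor
    [seq foldr And NE [seq literal (val i) (s i) | i <- fset_set [set: N]]
    | s <- fset_set X].

Definition classical_part (Gamma : set form) : set form :=
  [set psi | Gamma psi /\ classical psi].

(* [Gamma ⊢ phi] iff there is a derivation of [phi] all of whose undischarged
   assumptions belong to [Gamma]. In [d_tensorE] and [d_tensor_sub] the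
   subderivations may use, besides the discharged assumption, only the
   classical elements of [Gamma]. *)
Reserved Notation "Gamma ⊢ phi" (at level 70, no associativity).
Inductive derives : set form -> form -> Prop :=
| d_assumption (Gamma : set form) phi : Gamma phi -> Gamma ⊢ phi
| d_axiom Gamma i : Gamma ⊢ Tensor (Var i) (NegVar i)
| d_andI Gamma phi psi :
    Gamma ⊢ phi -> Gamma ⊢ psi -> Gamma ⊢ And phi psi
| d_andEl Gamma phi psi : Gamma ⊢ And phi psi -> Gamma ⊢ phi
| d_andEr Gamma phi psi : Gamma ⊢ And phi psi -> Gamma ⊢ psi
| d_tensorI Gamma phi psi :
    NE_free psi -> Gamma ⊢ phi -> Gamma ⊢ Tensor phi psi
| d_tensorI_same Gamma phi : Gamma ⊢ phi -> Gamma ⊢ Tensor phi phi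
| d_tensorE Gamma phi psi alpha :
    classical alpha ->
    Gamma ⊢ Tensor phi psi ->
    phi |` classical_part Gamma ⊢ alpha ->
    psi |` classical_part Gamma ⊢ alpha ->
    Gamma ⊢ alpha
| d_tensor_sub Gamma phi psi chi :
    Gamma ⊢ Tensor phi psi ->
    psi |` classical_part Gamma ⊢ chi ->
    Gamma ⊢ Tensor phi chi
| d_tensorC Gamma phi psi :
    Gamma ⊢ Tensor phi psi -> Gamma ⊢ Tensor psi phi
| d_tensorA Gamma phi psi chi :
    Gamma ⊢ Tensor phi (Tensor psi chi) ->
    Gamma ⊢ Tensor (Tensor phi psi) chi
| d_contradiction Gamma i :
    Gamma ⊢ And (Var i) (NegVar i) -> Gamma ⊢ Bot
| d_botE Gamma phi : Gamma ⊢ Tensor phi Bot -> Gamma ⊢ phi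
| d_exfalso Gamma phi : Gamma ⊢ And Bot NE -> Gamma ⊢ phi
| d_contr_contraction Gamma phi :
    Gamma ⊢ Tensor phi (And Bot NE) -> Gamma ⊢ And Bot NE
| d_Theta_contr Gamma (N : set nat) (X Y : team N) :
    finite_set N -> X <> Y ->
    Gamma ⊢ And (Theta X) (Theta Y) -> Gamma ⊢ And Bot NE
| d_distr Gamma alpha psi chi :
    classical alpha ->
    Gamma ⊢ And alpha (Tensor psi chi) ->
    Gamma ⊢ Tensor (And alpha psi) (And alpha chi)
| d_strongE1 Gamma (N : set nat) phi m theta :
    finite_set N ->
    subform_at phi m = Some NE ->
    Gamma ⊢ phi ->
    (forall Y : team N, Y <> set0 ->
       replace (Theta Y) phi m |` Gamma ⊢ theta) ->
    Gamma ⊢ theta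
| d_strongE2 Gamma phi psi m theta :
    subform_at phi m = Some psi ->
    Gamma ⊢ phi ->
    replace (And psi Bot) phi m |` Gamma ⊢ theta ->
    replace (And psi NE) phi m |` Gamma ⊢ theta ->
    Gamma ⊢ theta
| d_atomI Gamma (a : atom L) (N : set nat) (Y : team N) :
    finite_set N -> [set` atom_idx a] `<=` N ->
    atom_sat a Y ->
    Gamma ⊢ Theta Y -> Gamma ⊢ Atom a
| d_atomE Gamma (a : atom L) (N : set nat) phi m theta :
    finite_set N -> [set` atom_idx a] `<=` N ->
    subform_at phi m = Some (Atom a) ->
    Gamma ⊢ phi ->
    (forall Y : team N, atom_sat a Y ->
       replace (Theta Y) phi m |` Gamma ⊢ theta) ->
    Gamma ⊢ theta
where "Gamma ⊢ phi" := (derives Gamma phi).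

End Syntax.

Notation "Gamma ⊢ phi" := (derives Gamma phi) (at level 70, no associativity).
Notation "Gamma ⊨ phi" := (entails Gamma phi) (at level 70, no associativity).

(* Main.v *)
From mathcomp Require Import finmap functions cardinality.
Require Import Defs.
From mathcomp Require Import all_boot boolp classical_sets.

Set Implicit Arguments.
Unset Strict Implicit.
Unset Printing Implicit Defensive.

Local Open Scope classical_set_scope.

(** A derivation may pass through formulas mentioning variables outside the
    domain of the given team, so soundness is first proved for teams of total
    valuations (domain [setT]) and then transferred to an arbitrary domain by
    locality: satisfaction only depends on the restriction of the team to the
    indices of the formula.  The rules with replacement are sound because a
    satisfied formula assigns to each occurrence of a subformula a subteam that
    satisfies it, and replacing the subformula by anything that this subteam
    satisfies preserves the truth of the whole.  Finally, [Theta X] holds in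
    exactly the teams whose restriction to the domain of [X] is [X]. *)

Lemma valueE (N : set nat) (s : N -> bool) (i : N) : value s (val i) = Some (s i).
Proof. by rewrite /value valK. Qed.

(** * Restriction of teams to a smaller domain *)

Section Restriction.
Variables (M N : set nat) (MN : M `<=` N).

(** The pointwise form in which the literals of [Theta] express agreement with [s]. *)
Lemma comp_inclusionE (t : N -> bool) (s : M -> bool) :
  t \o inclusion MN = s <-> forall i, value t (val i) = Some (s i).
Proof.
have E (i : M) : value t (val i) = Some (t (inclusion MN i)).
  by rewrite -(valueE t (inclusion MN i)).
split=> [<- i|H]; first by rewrite E.
by apply/funext => i; have := H i; rewrite E => -[].
Qed.

Lemma restrict_set0 (X : team N) : restrict MN X = set0 <-> X = set0.
Proof. by split=> [/image_set0_set0|->] //; rewrite /restrict image_set0. Qed.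

Lemma restrictU (X Y : team N) :
  restrict MN (X `|` Y) = restrict MN X `|` restrict MN Y.
Proof. exact: image_setU. Qed.

(* Restriction is a direct image, so a cover of the restricted team pulls back
   to a cover of the team. *)
Lemma restrict_eqU (X : team N) (Y Z : team M) :
  restrict MN X = Y `|` Z ->
  exists Y' Z', [/\ X = Y' `|` Z', restrict MN Y' = Y & restrict MN Z' = Z].
Proof.
move=> XYZ.
have R (V : team M) : V `<=` Y `|` Z ->
    restrict MN (X `&` [set s : N -> bool | V (s \o inclusion MN)]) = V.
  move=> VYZ; apply/seteqP; split=> [_ [s [_ Vs] <-] //|s Vs].
  have : restrict MN X s by rewrite XYZ; exact: VYZ.
  by case=> t Xt ts; exists t => //; split=> //=; rewrite ts.
exists (X `&` [set s : N -> bool | Y (s \o inclusion MN)]),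
  (X `&` [set s : N -> bool | Z (s \o inclusion MN)]).
split; [|apply: R => s; by left|apply: R => s; by right].
rewrite -setIUr; apply/esym/setIidPl => s Xs.
have : restrict MN X (s \o inclusion MN) by exists s.
by rewrite XYZ.
Qed.

Lemma restrict_surj (X : team M) : exists X' : team N, restrict MN X' = X.
Proof.
exists [set s : N -> bool | X (s \o inclusion MN)].
apply/seteqP; split=> [_ [s Xs <-] //|s Xs].
(* [t] extends [s] to [N] with the default value [false] outside [M]. *)
pose t (j : N) := odflt false (value s (val j)).
have ts : t \o inclusion MN = s.
  by apply/funext => i; rewrite /= /t valueE.
by exists t => //=; rewrite ts.
Qed.

End Restriction.

Lemma restrict_comp (K M N : set nat) (KM : K `<=` M) (MN : M `<=` N)
    (KN : K `<=` N) (X : team N) :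
  restrict KM (restrict MN X) = restrict KN X.
Proof.
rewrite /restrict image_comp; apply: eq_imagel => s _ /=.
by apply/funext => i /=; congr (s _); apply/val_inj.
Qed.

(** Every valuation on [N] comes from a function on a finite type. Hence [fset_set] really
    enumerates the team in [Theta]. *)
Lemma finite_team (N : set nat) (X : team N) : finite_set N -> finite_set X.
Proof.
move=> finN.
have finNT : finite_set [set: N] by rewrite (eq_finite_set (card_setT N)).
pose F : {fset N} := fset_set [set: N].
pose f (g : {ffun F -> bool}) (i : N) := if insub i is Some j then g j else false.
apply: (@sub_finite_set _ _ (range f)); last exact/finite_image/finite_finset.
move=> s _; exists [ffun j : F => s (val j)] => //.
apply/funext => i; rewrite /f.
have iF : i \in F by rewrite in_fset_set // in_setE.
by rewrite insubT ffunE.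
Qed.

(** * Locality, replacement and classical formulas *)

Section Soundness.
Variable L : newAtoms.
Implicit Types (phi psi : form L) (Gamma : set (form L)).

(** [newAtoms] gives locality only at the exact index set of [a]; both teams have the same
    restriction there. *)
Lemma atom_sat_restrict (a : atom L) (M N : set nat) (MN : M `<=` N)
    (X : team N) :
  [set` atom_idx a] `<=` M ->
  atom_sat a X <-> atom_sat a (restrict MN X).
Proof.
move=> aM; have aN : [set` atom_idx a] `<=` N by move=> i /aM /MN.
by rewrite (atom_sat_local aN) (atom_sat_local aM) restrict_comp.
Qed.

Lemma sat_restrict (M N : set nat) (MN : M `<=` N) (X : team N) phi :
  idx phi `<=` M -> sat X phi <-> sat (restrict MN X) phi.
Proof.
elim: phi X => [i|i|||a|p IHp q IHq|p IHp q IHq] X /=.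
- move=> /(_ i erefl) Mi; split=> [H _ [s Xs <-]|H s Xs].
    by rewrite value_restrict //; exact: H.
  by rewrite -(value_restrict MN) //; apply: H; exists s.
- move=> /(_ i erefl) Mi; split=> [H _ [s Xs <-]|H s Xs].
    by rewrite value_restrict //; exact: H.
  by rewrite -(value_restrict MN) //; apply: H; exists s.
- by rewrite restrict_set0.
- by rewrite restrict_set0.
- exact: atom_sat_restrict.
- by rewrite subUset => -[pM qM]; rewrite IHp // IHq.
- rewrite subUset => -[pM qM]; split=> [[Y [Z [-> Yp Zq]]]|[Y [Z [+ Yp Zq]]]].
    exists (restrict MN Y), (restrict MN Z).
    by split; [exact: restrictU|apply/IHp|apply/IHq].
  case/restrict_eqU=> Y' [Z' [-> YY ZZ]]; exists Y', Z'.
  by split=> //; [apply/IHp; rewrite ?YY|apply/IHq; rewrite ?ZZ].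
Qed.

(** On the way down to the occurrence, a conjunction keeps the team and a tensor passes to one part.
    [Y] is fixed before [beta], so [beta] may be chosen according to [Y]. *)
Lemma sat_replace (N : set nat) (X : team N) phi m psi :
  subform_at phi m = Some psi -> sat X phi ->
  exists2 Y : team N, sat Y psi &
    forall beta, sat Y beta -> sat X (replace beta phi m).
Proof.
elim: phi m X => [i|i|||a|p IHp q IHq|p IHp q IHq] m X /=;
  (case: eqP => [_ [<-]|_] //; first by exists X).
- case: leqP => _ + [Xp Xq].
    by case/IHp/(_ Xp)=> Y Ypsi HY; exists Y => //= beta /HY.
  by case/IHq/(_ Xq)=> Y Ypsi HY; exists Y => //= beta /HY.
- case: leqP => _ + [Y [Z [-> Yp Zq]]].
    by case/IHp/(_ Yp)=> W Wpsi HW; exists W => //= beta /HW; exists Y, Z.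
  by case/IHq/(_ Zq)=> W Wpsi HW; exists W => //= beta /HW; exists Y, Z.
Qed.

(** Flatness, the source of closure under subteams and unions. On a singleton the tensor acts as a
    disjunction, the other part being empty. *)
Lemma sat_classicalP (N : set nat) (X : team N) phi : classical phi ->
  sat X phi <-> forall s, X s -> sat [set s] phi.
Proof.
elim: phi X => [i|i|||a|p IHp q IHq|p IHp q IHq] X //=.
- by move=> _; split=> [H s Xs _ ->|H s Xs]; [exact: H|exact: (H s Xs s)].
- by move=> _; split=> [H s Xs _ ->|H s Xs]; [exact: H|exact: (H s Xs s)].
- move=> _; split=> [-> //|H]; rewrite -subset0 => s /H s0.
  by rewrite -s0.
- case=> cp cq; rewrite IHp // IHq //.
  split=> [[Hp Hq] s Xs|H]; first by split; [exact: Hp|exact: Hq].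
  by split=> s /H[].
- case=> cp cq; split=> [[Y [Z [-> /IHp-/(_ cp) Hp /IHq-/(_ cq) Hq]]]|H].
    have sat0 phi : (forall X : team N, classical phi ->
        sat X phi <-> forall s, X s -> sat [set s] phi) ->
        classical phi -> sat (set0 : team N) phi.
      by move=> IH c; apply/IH.
    move=> s [/Hp Ys|/Hq Zs].
      by exists [set s], set0; rewrite setU0; split=> //; exact: sat0.
    by exists set0, [set s]; rewrite set0U; split=> //; exact: sat0.
  (* Each part collects all the valuations at which its disjunct holds. *)
  exists [set s | X s /\ sat [set s] p], [set s | X s /\ sat [set s] q].
  split; [|by apply/IHp => // s []|by apply/IHq => // s []].
  apply/seteqP; split=> [s Xs|s [[]|[]] //].
  have [Y [Z [sYZ Yp Zq]]] := H s Xs.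
  have : (Y `|` Z) s by rewrite -sYZ.
  case=> [Ys|Zs]; [left|right]; split=> //.
    by move/IHp: Yp; apply.
  by move/IHq: Zq; apply.
Qed.

Lemma sat_classical_sub (N : set nat) (X Y : team N) phi :
  classical phi -> Y `<=` X -> sat X phi -> sat Y phi.
Proof.
by move=> c YX /(sat_classicalP X c) H; apply/sat_classicalP => // s /YX; exact: H.
Qed.

Lemma sat_classicalU (N : set nat) (X Y : team N) phi :
  classical phi -> sat X phi -> sat Y phi -> sat (X `|` Y) phi.
Proof.
move=> c /(sat_classicalP X c) HX /(sat_classicalP Y c) HY.
by apply/sat_classicalP => // s [/HX|/HY].
Qed.

(** Atoms have the empty team property, and a tensor splits the empty team into two empty parts. *)
Lemma sat_NE_free_set0 (N : set nat) phi :
  idx phi `<=` N -> NE_free phi -> sat (set0 : team N) phi.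
Proof.
elim: phi => [i|i|||a|p IHp q IHq|p IHp q IHq] //=.
- by move=> aN _; exact: atom_sat_empty.
- by rewrite subUset => -[pN qN] [fp fq]; split; [exact: IHp|exact: IHq].
- rewrite subUset => -[pN qN] [fp fq]; exists set0, set0.
  by rewrite setU0; split=> //; [exact: IHp|exact: IHq].
Qed.

Lemma sat_tensor_bot (N : set nat) (X : team N) phi :
  sat X (Tensor phi (Bot L)) <-> sat X phi.
Proof.
split=> [[Y [_ [-> Yp ->]]]|Xp]; first by rewrite setU0.
by exists X, set0; rewrite setU0.
Qed.

(** Tensoring with [Bot] changes nothing, so the one-element case of [bigTensor] unfolds like the
    others. *)
Lemma sat_bigTensor_cons (N : set nat) (X : team N) phi (fs : seq (form L)) :
  sat X (bigTensor (phi :: fs)) <-> sat X (Tensor phi (bigTensor fs)).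
Proof. by case: fs => [|psi fs] //; rewrite sat_tensor_bot. Qed.

(** * Teams described by [Theta] *)

Section Theta.
Variables (M N : set nat) (MN : M `<=` N).
Hypothesis finM : finite_set M.

Lemma sat_literal (W : team N) i b :
  sat W (literal L i b) <-> forall t, W t -> value t i = Some b.
Proof. by case: b. Qed.

Lemma sat_literals (W : team N) (s : M -> bool) (l : seq M) :
  sat W (foldr (@And L) (NE L) [seq literal L (val i) (s i) | i <- l]) <->
  W <> set0 /\ forall t, W t -> forall i, i \in l -> value t (val i) = Some (s i).
Proof.
elim: l => [|i l IH]; first by split=> [|[]].
rewrite [sat _ _]/= sat_literal IH; split=> [[Hi [W0 Hl]]|[W0 H]].
  by split=> // t Wt j; rewrite inE => /orP[/eqP ->|]; [exact: Hi|exact: Hl].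
split=> [t Wt|]; first by apply: H => //; rewrite mem_head.
by split=> // t Wt j jl; apply: H => //; rewrite inE jl orbT.
Qed.

Lemma sat_Theta (W : team N) (X : team M) :
  sat W (Theta L X) <-> restrict MN W = X.
Proof.
have finMT : finite_set [set: M] by rewrite (eq_finite_set (card_setT M)).
pose f (s : M -> bool) := foldr (@And L) (NE L)
  [seq literal L (val i) (s i) | i <- fset_set [set: M]].
(* [NE] supplies a valuation in [V]; the literals force every one to restrict to [s]. *)
have fP (V : team N) s : sat V (f s) <-> restrict MN V = [set s].
  rewrite sat_literals; split=> [[/eqP/set0P[t Vt] H]|Vs].
    have Hs u : V u -> u \o inclusion MN = s.
      by move=> Vu; apply/comp_inclusionE => i; apply: H; rewrite // in_fset_set ?in_setE.
    apply/seteqP; split=> [_ [u /Hs us <-] //|_ ->].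
    by exists t => //; exact: Hs.
  split=> [V0|t Vt i _].
    have : [set s] s by [].
    by rewrite -Vs V0; case.
  apply: (comp_inclusionE MN t s).1.
  have : restrict MN V (t \o inclusion MN) by exists t.
  by rewrite Vs.
(* A tensor unites the restrictions of its parts, here one singleton for each entry of [l]. *)
have bP (l : seq (M -> bool)) V :
    sat V (bigTensor [seq f s | s <- l]) <-> restrict MN V = [set` l].
  elim: l V => [|s l IH] V.
    by rewrite set_nil restrict_set0.
  have -> : [set` s :: l] = s |` [set` l].
    apply/seteqP; split=> t /=; last by rewrite inE => -[->|/= ->]; rewrite ?eqxx ?orbT.
    by rewrite inE => /orP[/eqP ->|tl]; [left|right].
  rewrite sat_bigTensor_cons.
  split=> [[Y [Z [-> /fP Ys /IH Zl]]]|/restrict_eqU[Y [Z [-> Ys Zl]]]].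
    by rewrite restrictU Ys Zl.
  by exists Y, Z; split=> //; [apply/fP|apply/IH].
by rewrite bP; have -> : [set` fset_set X] = X by rewrite fset_setK //; exact: finite_team.
Qed.

End Theta.

(** * Soundness over total valuations *)

Lemma sat_cons (N : set nat) (X : team N) Gamma psi :
  sat X psi -> (forall phi, Gamma phi -> sat X phi) ->
  forall phi, (psi |` Gamma) phi -> sat X phi.
Proof. by move=> Xpsi XG phi [->|/XG]. Qed.

(** Classical assumptions survive on each part of a split team, so subderivations of the tensor
    rules may use them. *)
Lemma sat_classical_part (N : set nat) (X Y : team N) Gamma :
  Y `<=` X -> (forall phi, Gamma phi -> sat X phi) ->
  forall phi, classical_part Gamma phi -> sat Y phi.
Proof. by move=> YX XG phi [/XG Xphi c]; exact: sat_classical_sub Xphi. Qed.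

Lemma soundness_total Gamma phi : Gamma ⊢ phi ->
  forall X : team [set: nat], (forall psi, Gamma psi -> sat X psi) -> sat X phi.
Proof.
elim=> {Gamma phi}.
- by move=> Gamma phi Gphi X; exact.
(* Split by the value at [i], which is defined because the domain is total. *)
- move=> Gamma i X _; exists (X `&` [set s | value s i = Some true]),
    (X `&` [set s | value s i = Some false]).
  split; [|by move=> s []|by move=> s []].
  rewrite -setIUr; apply/esym/setIidPl => s _ /=.
  have iT : i \in [set: nat] by rewrite in_setE.
  rewrite /setU /= /value (insubT (mem [set: nat]) iT) /=.
  by case: (s _); [left|right].
- by move=> Gamma phi psi _ IH1 _ IH2 X XG; split; [exact: IH1|exact: IH2].
- by move=> Gamma phi psi _ IH X /IH[].
- by move=> Gamma phi psi _ IH X /IH[].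
- move=> Gamma phi psi fpsi _ IH X /IH Xphi; exists X, set0.
  by rewrite setU0; split=> //; exact: sat_NE_free_set0.
- by move=> Gamma phi _ IH X /IH Xphi; exists X, X; rewrite setUid.
(* [alpha] holds on both parts, hence on their union by classicality. *)
- move=> Gamma phi psi alpha calpha _ IH _ IH1 _ IH2 X XG.
  have [Y [Z [XYZ Yphi Zpsi]]] := IH X XG; rewrite XYZ.
  apply: sat_classicalU => //; [apply: IH1|apply: IH2]; apply: sat_cons => //;
    by apply: sat_classical_part XG; rewrite XYZ; (exact: subsetUl || exact: subsetUr).
- move=> Gamma phi psi chi _ IH _ IH1 X XG.
  have [Y [Z [XYZ Yphi Zpsi]]] := IH X XG; exists Y, Z; split=> //.
  apply: IH1; apply: sat_cons => //.
  by apply: sat_classical_part XG; rewrite XYZ; exact: subsetUr.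
- by move=> Gamma phi psi _ IH X /IH[Y [Z [-> ? ?]]]; exists Z, Y; rewrite setUC.
- move=> Gamma phi psi chi _ IH X /IH[Y [_ [-> ? [Z [W [-> ? ?]]]]]].
  by exists (Y `|` Z), W; rewrite setUA; split=> //; exists Y, Z.
- move=> Gamma i _ IH X /IH[Xt Xf] /=; rewrite -subset0 => s Xs.
  by have := Xt s Xs; rewrite (Xf s Xs).
- by move=> Gamma phi _ IH X /IH /sat_tensor_bot.
- by move=> Gamma phi _ IH X /IH[].
- by move=> Gamma phi _ IH X /IH[? [? [_ _ []]]].
- move=> Gamma N X Y finN XY _ IH W /IH[].
  by move=> /(sat_Theta (@subsetT _ N) finN) WX /(sat_Theta (@subsetT _ N) finN) WY;
    case: XY; rewrite -WX.
- move=> Gamma alpha psi chi calpha _ IH X /IH[Xalpha [Y [Z [XYZ Ypsi Zchi]]]].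
  exists Y, Z; split=> //; split=> //; apply: sat_classical_sub Xalpha => //;
    by rewrite XYZ; (exact: subsetUl || exact: subsetUr).
- move=> Gamma N phi m theta finN phim _ IH _ IH1 X XG.
  have [Y Y0 HY] := sat_replace phim (IH X XG).
  (* The premise to use is the one for the restriction to [N] of the team found at the
     occurrence. *)
  apply: (IH1 (restrict (@subsetT _ N) Y)); first by rewrite restrict_set0.
  by apply: sat_cons => //; apply: HY; apply/(sat_Theta (@subsetT _ N)).
- move=> Gamma phi psi m theta phim _ IH _ IH1 _ IH2 X XG.
  have [Y Ypsi HY] := sat_replace phim (IH X XG).
  (* Emptiness of the team at the occurrence selects the premise. *)
  have [Y0|Y0] := pselect (Y = set0).
    by apply: IH1; apply: sat_cons => //; exact: HY.
  by apply: IH2; apply: sat_cons => //; exact: HY.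
- move=> Gamma a N Y finN aN aY _ IH X /IH /(sat_Theta (@subsetT _ N) finN) XY.
  by apply/(atom_sat_restrict (@subsetT _ N)) => //; rewrite XY.
- move=> Gamma a N phi m theta finN aN phim _ IH _ IH1 X XG.
  have [Y aY HY] := sat_replace phim (IH X XG).
  apply: (IH1 (restrict (@subsetT _ N) Y)).
    exact/(atom_sat_restrict (@subsetT _ N)).
  by apply: sat_cons => //; apply: HY; apply/(sat_Theta (@subsetT _ N)).
Qed.

End Soundness.

Theorem theorem5p18 (L : newAtoms) (Gamma : set (form L)) (phi : form L) :
  Gamma ⊢ phi -> Gamma ⊨ phi.
Proof.
move=> Gphi N X GN phiN XG.
have [X' XX'] := restrict_surj (@subsetT _ N) X.
(* Locality lifts the goal to [X']; the assumptions are then brought back to [X]. *)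
rewrite -XX' -sat_restrict //; apply: soundness_total Gphi _ _ => psi Gpsi.
by rewrite (sat_restrict (@subsetT _ N)) ?XX'; [exact: XG|exact: GN].
Qed.
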